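(* Let $\sigma>0$ be fixed. Any Borel probability measure $\alpha$ on $\mathbb{R}^d$ is completely determined by the Fréchet function $V_\alpha(\cdot,\sigma)\colon\mathbb{R}^d\to\mathbb{R}$ associated with the Gaussian kernel at scale $\sigma$; that is, if $\alpha$ and $\beta$ are Borel probability measures on $\mathbb{R}^d$ with $V_\alpha(x,\sigma)=V_\beta(x,\sigma)$ for all $x\in\mathbb{R}^d$, then $\alpha=\beta$.
   Context: The isotropic Gaussian kernel is $G(x,y,\sigma)=\frac{1}{(2\pi\sigma^2)^{d/2}}\exp\left(-\frac{\|y-x\|^2}{2\sigma^2}\right)$, and the associated multiscale Fréchet function of $\alpha$ is $V_\alpha(x,\sigma)=\int_{\mathbb{R}^d}\|y-x\|^2G(x,y,\sigma)\,\alpha(dy)$. *)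

(* Defs.v *)
From HB Require Import structures.
From mathcomp Require Import all_boot all_order all_algebra.
From mathcomp Require Import all_classical all_reals all_analysis.

Set Implicit Arguments.
Unset Strict Implicit.
Unset Printing Implicit Defensive.

Import Order.TTheory GRing.Theory Num.Theory.
Import numFieldNormedType.Exports.

Local Open Scope classical_set_scope.
Local Open Scope ring_scope.

(* R^d with its Borel sigma-algebra. The topology of 'rV[R]_d comes from the
   sup norm, which has the same open sets as the Euclidean norm. *)
Notation borel_rV R d := (g_sigma_algebraType (@open 'rV[R]_d)).

(* The library's norm `|x| on 'rV[R]_d is the sup norm, hence this one. *)
Definition enorm (R : realType) (d : nat) (x : 'rV[R]_d) : R :=
  Num.sqrt (\sum_(i < d) x ord0 i ^+ 2).

Definition gauss_kernel (R : realType) (d : nat) (x y : 'rV[R]_d)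
    (sigma : R) : R :=
  ((2 * pi * sigma ^+ 2) `^ (d%:R / 2))^-1 *
  expR (- (enorm (y - x) ^+ 2 / (2 * sigma ^+ 2))).

(* For sigma > 0 the integrand is nonnegative and bounded, so the integral is
   finite and the real-valued [Rintegral] loses no information. *)
Definition frechet (R : realType) (d : nat)
    (alpha : probability (borel_rV R d) R) (x : 'rV[R]_d) (sigma : R) : R :=
  \int[alpha]_(y in [set: borel_rV R d])
    (enorm ((y : 'rV[R]_d) - x) ^+ 2 * gauss_kernel x y sigma).

(* Main.v *)
(* The frechet function is, up to a positive constant, the convolution of the
   measure with |z|^2 exp(- |z|^2 / (2 sigma^2)), whose Fourier transform at xi
   is a positive multiple of (d - sigma^2 |xi|^2) exp(- sigma^2 |xi|^2 / 2).
   Hence the characteristic functions of alpha and beta agree off the sphere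
   |xi|^2 = d / sigma^2, and by continuity also on it.

   Equality of characteristic functions then passes to the measures: the bounded
   functions u such that multiplication by u preserves the property "all
   integrals against waves cos(a.y + b) agree" form an algebra that contains the
   waves and is closed under bounded pointwise limits.  So the sets whose
   indicators have this property form a sigma-algebra; it contains the
   half-spaces, hence the Borel sets. *)
Require Import Defs.
From mathcomp Require Import all_boot all_order all_algebra.
From mathcomp Require Import all_classical all_reals all_analysis.
From mathcomp Require Import measurable_realfun ring lra.

Set Implicit Arguments.
Unset Strict Implicit.
Unset Printing Implicit Defensive.

Import Order.TTheory GRing.Theory Num.Theory.
Import numFieldNormedType.Exports.

Local Open Scope classical_set_scope.
Local Open Scope ring_scope.

(** * Trigonometric moments of Gaussians *)

Section gaussian_line.
Context {R : realType}.
Local Notation mu := (@lebesgue_measure R).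
Implicit Types s m t x c xi : R.

(** Unnormalised, with peak value 1: the Gaussian kernel has one such factor per coordinate, and the
    normalising constant is handled apart. *)
Definition gauss s t : R := expR (- (t ^+ 2 / (2 * s ^+ 2))).

Lemma gauss_ge0 s t : 0 <= gauss s t. Proof. exact: expR_ge0. Qed.

Lemma gauss_le1 s t : gauss s t <= 1.
Proof.
rewrite -expR0 ler_expR oppr_le0 divr_ge0 ?sqr_ge0//.
by rewrite mulr_ge0 ?sqr_ge0.
Qed.

Lemma gaussN s t : gauss s (- t) = gauss s t.
Proof. by rewrite /gauss sqrrN. Qed.

Lemma measurable_gauss s : measurable_fun setT (gauss s).
Proof.
apply: (measurableT_comp (@measurable_expR R)).
by apply: measurableT_comp => //; apply: measurable_funM => //.
Qed.

Lemma is_derive_gauss s m x : s != 0 ->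
  is_derive x 1 (fun x => gauss s (x - m))
    (- ((x - m) / s ^+ 2) * gauss s (x - m)).
Proof.
move=> s0; rewrite /gauss.
apply: is_derive_eq.
rewrite /GRing.scale/=.
by field.
Qed.

Lemma continuous_gauss s m : s != 0 -> continuous (fun x => gauss s (x - m)).
Proof.
move=> s0 x; apply/differentiable_continuous/derivable1_diffP.
by have [] := is_derive_gauss m x s0.
Qed.

(** Bridge to the normal density, from which integrability and the total integral are read off. *)
Lemma gaussE s m x : s != 0 ->
  gauss s (x - m) = (normal_peak s)^-1 * normal_pdf m s x.
Proof.
move=> s0; rewrite normal_pdfE//= mulKf ?gt_eqF ?normal_peak_gt0//.
by rewrite /gauss /normal_fun mulNr mulr_natl.
Qed.

Lemma integrable_gauss s m : s != 0 ->
  mu.-integrable setT (EFin \o (fun x => gauss s (x - m))).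
Proof.
move=> s0; rewrite (_ : _ \o _ =
  fun x => ((normal_peak s)^-1%:E * (normal_pdf m s x)%:E)%E); last first.
  by apply/funext => x /=; rewrite gaussE.
by apply: integrableZl => //; exact: integrable_normal_pdf.
Qed.

Lemma Rintegral_gauss s m : s != 0 ->
  \int[mu]_x gauss s (x - m) = (normal_peak s)^-1.
Proof.
move=> s0; under eq_Rintegral do rewrite gaussE//.
rewrite RintegralZl//; last exact: integrable_normal_pdf.
by rewrite /Rintegral integral_normal_pdf mulr1.
Qed.

Lemma gauss_cvg0 s m : s != 0 -> gauss s (n%:R - m) @[n --> \oo] --> 0.
Proof.
move=> s0; rewrite /gauss.
apply: (@cvg_comp _ _ _ (fun n => (n%:R - m) ^+ 2 / (2 * s ^+ 2))
  (fun x : R => expR (- x)) _ (pinfty_nbhs R)); last exact: cvgr_expR.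
have s2 : 0 < 2 * s ^+ 2 by rewrite mulr_gt0// exprn_even_gt0.
apply/cvgryPge => A; near=> n.
rewrite ler_pdivlMr//.
set B := A * _.
have nm : `|B| + 1 <= n%:R - m.
  by rewrite lerBrDr; near: n; exact: nbhs_infty_ger.
have := ler_norm B.
have := normr_ge0 B; nra.
Unshelve. all: by end_near. Qed.

(** With u = t^2 / (4 s^2) the claim reduces to 1 + 4 s^2 u <= (1 + 4 s^2) e^u, which follows from 1
    + u <= e^u. Widening the Gaussian by sqrt 2 thus absorbs a quadratic factor; the dominating
    functions for the moments below are of this form. *)
Lemma sqr_gauss_le s t : s != 0 ->
  (1 + t ^+ 2) * gauss s t <= (1 + 4 * s ^+ 2) * gauss (Num.sqrt 2 * s) t.
Proof.
move=> s0; rewrite /gauss exprMn sqr_sqrtr//.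
have s2 : 0 < s ^+ 2 by rewrite exprn_even_gt0.
set u := t ^+ 2 / (2 * (2 * s ^+ 2)).
have -> : t ^+ 2 / (2 * s ^+ 2) = u + u by rewrite /u; field.
have tu : t ^+ 2 = 4 * s ^+ 2 * u by rewrite /u; field.
have u0 : 0 <= u by rewrite /u mulr_ge0 ?invr_ge0 ?sqr_ge0// mulr_ge0// mulr_ge0 ?sqr_ge0.
rewrite opprD expRD mulrA ler_wpM2r ?expR_ge0// tu expRN.
rewrite ler_pdivrMr ?expR_gt0//.
have := expR_ge1Dx u; nra.
Qed.

Lemma gauss_poly_le s t (a : R) : s != 0 -> `|a| <= 1 + t ^+ 2 ->
  `|a * gauss s t| <= (1 + 4 * s ^+ 2) * gauss (Num.sqrt 2 * s) t.
Proof.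
move=> s0 at2; rewrite normrM (ger0_norm (gauss_ge0 _ _)).
by rewrite (le_trans _ (sqr_gauss_le t s0))// ler_wpM2r// gauss_ge0.
Qed.

Lemma sqrt2M_neq0 s : s != 0 -> Num.sqrt 2 * s != 0.
Proof. by move=> s0; rewrite mulf_neq0// sqrtr_eq0 -ltNge. Qed.

Lemma integrable_gauss_dominated s m (K : R) (f : R -> R) : s != 0 ->
  measurable_fun setT f -> (forall x, `|f x| <= K * gauss s (x - m)) ->
  mu.-integrable setT (EFin \o f).
Proof.
move=> s0 mf fK.
refine (@le_integrable _ _ _ mu setT _ _
  (EFin \o (fun x => K * gauss s (x - m))) _ _ _) => //.
- exact/measurable_EFinP.
- by move=> x _ /=; rewrite lee_fin (le_trans (fK x))// ler_norm.
- rewrite (_ : _ \o _ = fun x => (K%:E * (gauss s (x - m))%:E)%E)//.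
  by apply: integrableZl => //; exact: integrable_gauss.
Qed.

(** The fundamental theorem of calculus on [-(n+1), n+1] leaves boundary terms that the Gaussian
    bound sends to 0; dominated convergence, with |f| as majorant, passes to the whole line. This
    replaces integration by parts. *)
Lemma Rintegral_derive_eq0 s m (K : R) (F f : R -> R) : s != 0 ->
  (forall x, is_derive x 1 F (f x)) -> continuous f ->
  (forall x, `|F x| <= K * gauss s (x - m)) ->
  (forall x, `|f x| <= K * gauss s (x - m)) ->
  \int[mu]_x f x = 0.
Proof.
move=> s0 dF cf FK fK.
have mf : measurable_fun setT f by exact: continuous_measurable_fun.
have intf := integrable_gauss_dominated s0 mf fK.
pose I (n : nat) : set R := `[- n.+1%:R, n.+1%:R]%classic.
pose fn n := f \_ (I n).
have cv : (\int[mu]_x (fn n x)%:E @[n --> \oo] --> \int[mu]_x (f x)%:E)%E.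
  have := @dominated_cvg _ _ _ mu setT measurableT (fun n x => (fn n x)%:E)
    (EFin \o f) (fun x => (`|f x|)%:E).
  apply.
  - move=> n; apply/measurable_EFinP; apply/measurable_restrict => //.
      exact: measurable_itv.
    exact: measurable_funTS.
  - move=> x _; apply: cvg_near_cst; near=> n.
    rewrite /fn patchE ifT// inE /I/= in_itv/= -ler_norml.
    apply: ltW; apply: (@lt_trans _ _ n%:R); last by rewrite ltr_nat.
    by near: n; exact: nbhs_infty_gtr.
  - by move=> x _.
  - exact: (integrable_norm intf).
  - move=> n x _; rewrite lee_fin /fn patchE; case: ifP => // _.
    by rewrite normr0.
have FTC n : (\int[mu]_x (fn n x)%:E = (F n.+1%:R - F (- n.+1%:R))%:E)%E.
  transitivity (\int[mu]_(x in I n) (f x)%:E)%E.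
    rewrite [RHS]integral_mkcond; apply: eq_integral => x _.
    by rewrite /fn !patchE; case: ifP.
  rewrite EFinB; apply: continuous_FTC2.
  - by apply: (@lt_trans _ _ 0); rewrite ?oppr_lt0 ltr0n.
  - exact: continuous_subspaceT.
  - split.
    + by move=> x _; have [] := dF x.
    + apply: cvg_at_right_filter.
      by apply/differentiable_continuous/derivable1_diffP; have [] := dF (- n.+1%:R).
    + apply: cvg_at_left_filter.
      by apply/differentiable_continuous/derivable1_diffP; have [] := dF (n.+1%:R).
  - by move=> x _; rewrite derive1E; have [_ ->] := dF x.
have F0 (u : nat -> R) m' : (forall n, `|u n| <= K * gauss s (n.+1%:R - m')) ->
    u n @[n --> \oo] --> 0.
  move=> uK; apply: norm_cvg0; apply: (@squeeze_cvgr _ _ _ _ (cst 0)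
    (fun n => K * gauss s (n.+1%:R - m'))).
  - by apply: nearW => n; rewrite normr_ge0 uK.
  - exact: cvg_cst.
  - rewrite -(mulr0 K); apply: cvgMr.
    have := gauss_cvg0 m' s0.
    by rewrite -(cvg_shiftS (fun n => gauss s (n%:R - m'))).
have cF : (F n.+1%:R - F (- n.+1%:R) @[n --> \oo] --> 0).
  rewrite -[X in _ --> X](subr0 0); apply: cvgB.
  - by apply: (F0 _ m) => n.
  (* By evenness, the Gaussian centred at [m] and read at -(n+1) is the one centred at [- m] and
     read at n+1. *)
  - apply: (F0 _ (- m)) => n; rewrite (le_trans (FK _))//.
    by rewrite -gaussN opprD opprK opprK.
rewrite /Rintegral.
suff -> : (\int[mu]_x (f x)%:E = 0)%E by [].
apply: (cvg_unique _ cv) => //.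
have : ((F n.+1%:R - F (- n.+1%:R))%:E @[n --> \oo] --> 0%:E)%E.
  by apply: cvg_EFin => //; exact: nearW.
apply: cvg_trans; apply: near_eq_cvg; apply: nearW => n /=.
by rewrite -FTC.
Unshelve. all: by end_near. Qed.

Lemma norm_cos_le1 x : `|cos x| <= 1.
Proof. by rewrite ler_norml cos_geN1 cos_le1. Qed.

Lemma norm_sin_le1 x : `|sin x| <= 1.
Proof. by rewrite ler_norml sin_geN1 sin_le1. Qed.

Lemma is_derive_cosM m xi c x :
  is_derive x 1 (fun x => cos (xi * (x - m) + c)) (- xi * sin (xi * (x - m) + c)).
Proof.
apply: is_derive_eq; rewrite /GRing.scale/=; ring.
Qed.

Lemma is_derive_sinM m xi c x :
  is_derive x 1 (fun x => sin (xi * (x - m) + c)) (xi * cos (xi * (x - m) + c)).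
Proof.
apply: is_derive_eq; rewrite /GRing.scale/=; ring.
Qed.

Lemma continuous_cosM m xi c : continuous (fun x => cos (xi * (x - m) + c)).
Proof.
move=> x; apply/differentiable_continuous/derivable1_diffP.
by have [] := is_derive_cosM m xi c x.
Qed.

Lemma continuous_sinM m xi c : continuous (fun x => sin (xi * (x - m) + c)).
Proof.
move=> x; apply/differentiable_continuous/derivable1_diffP.
by have [] := is_derive_sinM m xi c x.
Qed.

Lemma continuous_pow (n : nat) m : continuous (fun x => (x - m) ^+ n).
Proof.
move=> x; apply: (@continuous_comp _ _ _ (fun x => x - m) (fun x => x ^+ n)).
  by apply: cvgB; [exact: cvg_id|exact: cvg_cst].
exact: exprn_continuous.
Qed.

Lemma continuous_poly_gauss s m (n : nat) (f : R -> R) : s != 0 ->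
  continuous f -> continuous (fun x => (x - m) ^+ n * gauss s (x - m) * f x).
Proof.
move=> s0 cf x; apply: cvgM; last exact: cf.
by apply: cvgM; [exact: continuous_pow|exact: continuous_gauss].
Qed.

Lemma norm_poly_gauss_le s t (n : nat) (a : R) : s != 0 -> (n <= 2)%N ->
  `|a| <= 1 ->
  `|t ^+ n * gauss s t * a| <= (1 + 4 * s ^+ 2) * gauss (Num.sqrt 2 * s) t.
Proof.
move=> s0 n2 a1; rewrite mulrAC; apply: gauss_poly_le => //.
have : `|t ^+ n * a| <= `|t| ^+ n.
  by rewrite normrM normrX ler_piMr// exprn_ge0.
move/le_trans; apply; rewrite -(real_normK (num_real t)).
have := normr_ge0 t.
move: n n2 => [|[|[|//]]] _; rewrite ?expr0 ?expr1; nra.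
Qed.

Lemma integrable_poly_gauss s m (n : nat) (f : R -> R) : s != 0 -> (n <= 2)%N ->
  continuous f -> (forall x, `|f x| <= 1) ->
  mu.-integrable setT (EFin \o (fun x => (x - m) ^+ n * gauss s (x - m) * f x)).
Proof.
move=> s0 n2 cf f1; apply: (integrable_gauss_dominated (sqrt2M_neq0 s0)).
  exact: continuous_measurable_fun (continuous_poly_gauss s0 cf).
by move=> x; apply: norm_poly_gauss_le.
Qed.

(* Both moments come from integrating the derivative of a Gaussian times a
   polynomial times a wave; the zeroth one solves F' = - s^2 xi F in xi. *)
Section trigonometric_moments.
Variables (s : R) (s0 : s != 0) (m : R).

Lemma Rintegral_gauss_sin xi c :
  \int[mu]_x ((x - m) ^+ 1 * gauss s (x - m) * sin (xi * (x - m) + c)) =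
  s ^+ 2 * xi * \int[mu]_x ((x - m) ^+ 0 * gauss s (x - m) * cos (xi * (x - m) + c)).
Proof.
set f1 := fun x => (x - m) ^+ 1 * gauss s (x - m) * sin (xi * (x - m) + c).
set f0 := fun x => (x - m) ^+ 0 * gauss s (x - m) * cos (xi * (x - m) + c).
have int1 : mu.-integrable setT (EFin \o f1).
  apply: integrable_poly_gauss => //; first exact: continuous_sinM.
  by move=> x; exact: norm_sin_le1.
have int0 : mu.-integrable setT (EFin \o f0).
  apply: integrable_poly_gauss => //; first exact: continuous_cosM.
  by move=> x; exact: norm_cos_le1.
rewrite -RintegralZl//; apply/eqP; rewrite -subr_eq0 -RintegralB//; last first.
  rewrite (_ : _ \o _ = fun x => ((s ^+ 2 * xi)%:E * (f0 x)%:E)%E)//.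
  exact: integrableZl.
apply/eqP.
(* Since g' = -(x - m) g / s^2, the derivative of this primitive is exactly [f1] - s^2 xi [f0]. The
   constant adds the bound s^2 for the primitive to the bound 1 + |s^2 xi| for its derivative. *)
apply: (@Rintegral_derive_eq0 (Num.sqrt 2 * s) m
  ((s ^+ 2 + (1 + `|s ^+ 2 * xi|)) * (1 + 4 * s ^+ 2))
  (fun x => - s ^+ 2 * (gauss s (x - m) * sin (xi * (x - m) + c)))).
- exact: sqrt2M_neq0.
- move=> x.
  have D1 := is_derive_gauss m x s0; have D2 := is_derive_sinM m xi c x.
  apply: is_derive_eq; rewrite /GRing.scale/= /f1 /f0.
  by field.
- move=> x; apply: cvgB; first exact: (continuous_poly_gauss s0 (@continuous_sinM _ _ _)).
  apply: cvgM; first exact: cvg_cst.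
  exact: (continuous_poly_gauss s0 (@continuous_cosM _ _ _)).
- move=> x.
  have := @norm_poly_gauss_le s (x - m) 0%N _ s0 isT (norm_sin_le1 (xi * (x - m) + c)).
  rewrite expr0 mul1r => h.
  rewrite normrM normrN (ger0_norm (sqr_ge0 _)) -mulrA.
  apply: ler_pM => //; first exact: sqr_ge0.
  by rewrite lerDl.
- move=> x; rewrite (le_trans (ler_normB _ _))// [`|_ * f0 x|]normrM.
  have h1 := @norm_poly_gauss_le s (x - m) 1%N _ s0 isT (norm_sin_le1 (xi * (x - m) + c)).
  have h0 := @norm_poly_gauss_le s (x - m) 0%N _ s0 isT (norm_cos_le1 (xi * (x - m) + c)).
  rewrite -[leRHS]mulrA.
  have a0 := normr_ge0 (s ^+ 2 * xi); have s2 := sqr_ge0 s.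
  have := ler_wpM2l a0 h0; rewrite -/(f0 x) -/(f1 x) in h1 *.
  set G := (1 + 4 * s ^+ 2) * _ in h1 *.
  have G0 : 0 <= G := le_trans (normr_ge0 _) h1.
  nra.
Qed.

Lemma Rintegral_sqr_gauss_cos xi c :
  \int[mu]_x ((x - m) ^+ 2 * gauss s (x - m) * cos (xi * (x - m) + c)) =
  s ^+ 2 * (1 - s ^+ 2 * xi ^+ 2) *
  \int[mu]_x ((x - m) ^+ 0 * gauss s (x - m) * cos (xi * (x - m) + c)).
Proof.
set f2 := fun x => (x - m) ^+ 2 * gauss s (x - m) * cos (xi * (x - m) + c).
set f0 := fun x => (x - m) ^+ 0 * gauss s (x - m) * cos (xi * (x - m) + c).
pose f1 := fun x => (x - m) ^+ 1 * gauss s (x - m) * sin (xi * (x - m) + c).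
have int2 : mu.-integrable setT (EFin \o f2).
  apply: integrable_poly_gauss => //; first exact: continuous_cosM.
  by move=> x; exact: norm_cos_le1.
have int1 : mu.-integrable setT (EFin \o f1).
  apply: integrable_poly_gauss => //; first exact: continuous_sinM.
  by move=> x; exact: norm_sin_le1.
have int0 : mu.-integrable setT (EFin \o f0).
  apply: integrable_poly_gauss => //; first exact: continuous_cosM.
  by move=> x; exact: norm_cos_le1.
have intZ (k : R) f : mu.-integrable setT (EFin \o f) ->
    mu.-integrable setT (EFin \o (fun x => k * f x)).
  move=> intf; rewrite (_ : _ \o _ = fun x => (k%:E * (f x)%:E)%E)//.
  exact: integrableZl.
have intB : mu.-integrable setT
    (EFin \o (fun x => s ^+ 2 * f0 x - s ^+ 2 * xi * f1 x)).
  rewrite (_ : _ \o _ =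
    fun x => ((s ^+ 2 * f0 x)%:E - (s ^+ 2 * xi * f1 x)%:E)%E)//.
  by apply: integrableB => //; exact: intZ.
suff : \int[mu]_x (f2 x - (s ^+ 2 * f0 x - s ^+ 2 * xi * f1 x)) = 0.
  rewrite RintegralB// => /subr0_eq ->.
  rewrite RintegralB//; [|exact: intZ..].
  rewrite !RintegralZl// Rintegral_gauss_sin.
  by ring.
(* The product rule gives [f2] - s^2 [f0] + s^2 xi [f1] as the derivative of this primitive; the
   three coefficients 1, s^2, |s^2 xi| make up the constant, and s^2 alone covers the primitive. *)
apply: (@Rintegral_derive_eq0 (Num.sqrt 2 * s) m
  ((1 + s ^+ 2 + `|s ^+ 2 * xi|) * (1 + 4 * s ^+ 2))
  (fun x => - s ^+ 2 * ((x - m) ^+ 1 * gauss s (x - m) * cos (xi * (x - m) + c)))).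
- exact: sqrt2M_neq0.
- move=> x.
  have D1 := is_derive_gauss m x s0; have D2 := is_derive_cosM m xi c x.
  apply: is_derive_eq; rewrite /GRing.scale/= /f2 /f1 /f0.
  by field.
- move=> x; apply: cvgB; first exact: (continuous_poly_gauss s0 (@continuous_cosM _ _ _)).
  apply: cvgB; apply: cvgM; [exact: cvg_cst| |exact: cvg_cst|].
    exact: (continuous_poly_gauss s0 (@continuous_cosM _ _ _)).
  exact: (continuous_poly_gauss s0 (@continuous_sinM _ _ _)).
- move=> x.
  have h := @norm_poly_gauss_le s (x - m) 1%N _ s0 isT (norm_cos_le1 (xi * (x - m) + c)).
  rewrite normrM normrN (ger0_norm (sqr_ge0 _)) -[leRHS]mulrA.
  apply: ler_pM => //; first exact: sqr_ge0.
  by rewrite -addrA addrC -addrA lerDl addr_ge0.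
- move=> x; rewrite (le_trans (ler_normB _ _))//.
  have h2 := @norm_poly_gauss_le s (x - m) 2%N _ s0 isT (norm_cos_le1 (xi * (x - m) + c)).
  have h1 := @norm_poly_gauss_le s (x - m) 1%N _ s0 isT (norm_sin_le1 (xi * (x - m) + c)).
  have h0 := @norm_poly_gauss_le s (x - m) 0%N _ s0 isT (norm_cos_le1 (xi * (x - m) + c)).
  rewrite -[leRHS]mulrA.
  have := ler_normB (s ^+ 2 * f0 x) (s ^+ 2 * xi * f1 x).
  rewrite [X in _ <= X + _]normrM [X in _ <= _ + X]normrM (ger0_norm (sqr_ge0 s)).
  have s2 := sqr_ge0 s; have a0 := normr_ge0 (s ^+ 2 * xi).
  have := ler_wpM2l a0 h1; have := ler_wpM2l s2 h0.
  rewrite -/(f0 x) -/(f1 x) -/(f2 x) in h2 *.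
  set G := (1 + 4 * s ^+ 2) * _ in h2 *.
  lra.
Qed.

Lemma Rintegral_gauss_cos xi c :
  \int[mu]_x ((x - m) ^+ 0 * gauss s (x - m) * cos (xi * (x - m) + c)) =
  (normal_peak s)^-1 * expR (- (s ^+ 2 * xi ^+ 2 / 2)) * cos c.
Proof.
pose f xi x := (x - m) ^+ 0 * gauss s (x - m) * cos (xi * (x - m) + c).
pose df xi x := - ((x - m) ^+ 1 * gauss s (x - m) * sin (xi * (x - m) + c)).
pose F xi := \int[mu]_x f xi x.
rewrite -/(F xi).
have int0 (y : R) : mu.-integrable setT (EFin \o f y).
  apply: integrable_poly_gauss => //; first exact: continuous_cosM.
  by move=> x; exact: norm_cos_le1.
have int1 (y : R) : mu.-integrable setT
    (EFin \o (fun x => (x - m) ^+ 1 * gauss s (x - m) * sin (y * (x - m) + c))).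
  apply: integrable_poly_gauss => //; first exact: continuous_sinM.
  by move=> x; exact: norm_sin_le1.
have d1 (y x : R) : is_derive y 1 (f ^~ x) (df y x).
  rewrite /f /df; apply: is_derive_eq; rewrite /GRing.scale/=.
  by ring.
(* Differentiation under the integral sign: [G] dominates the derivative uniformly in the frequency
   because |sin| <= 1, and [Rintegral_gauss_sin] turns the resulting sine moment back into [F]. *)
have dF (y : R) : is_derive y 1 F (- (s ^+ 2 * y * F y)).
  pose G x := (1 + 4 * s ^+ 2) * gauss (Num.sqrt 2 * s) (x - m).
  have Iy : `]y - 1, y + 1[%classic y.
    by rewrite /= in_itv/=; apply/andP; split; lra.
  have der x y' : `]y - 1, y + 1[%classic x -> [set: R] y' -> derivable (f ^~ y') x 1.
    by move=> _ _; have [] := d1 x y'.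
  have G0 x : 0 <= G x.
    by rewrite mulr_ge0 ?gauss_ge0// addr_ge0// mulr_ge0// sqr_ge0.
  have intG : mu.-integrable setT (EFin \o G).
    rewrite (_ : _ \o _ = fun x =>
      ((1 + 4 * s ^+ 2)%:E * (gauss (Num.sqrt 2 * s) (x - m))%:E)%E)//.
    by apply: integrableZl => //; apply/integrable_gauss/sqrt2M_neq0.
  have Gub x y' : `]y - 1, y + 1[%classic x -> [set: R] y' ->
      `|partial1of2 f x y'| <= G y'.
    move=> _ _; rewrite partial1of2E; have [_ ->] := d1 x y'.
    by rewrite normrN; apply: norm_poly_gauss_le => //; exact: norm_sin_le1.
  apply: DeriveDef.
    exact: (derivable_under_integral measurableT Iy (fun x _ => int0 x) der G0 intG Gub).
  rewrite -derive1E.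
  rewrite (differentiation_under_integral measurableT Iy (fun x _ => int0 x)
    der G0 intG Gub).
  transitivity (\int[mu]_x
    (-1 * ((x - m) ^+ 1 * gauss s (x - m) * sin (y * (x - m) + c)))).
    apply: eq_Rintegral => x _; rewrite partial1of2E; have [_ ->] := d1 y x.
    by rewrite mulN1r.
  by rewrite RintegralZl// Rintegral_gauss_sin mulN1r.
(* Integrating factor of the differential equation: [H] is constant, hence equal to its value at 0,
   the plain Gaussian integral times cos c. *)
pose H y := expR (s ^+ 2 * y ^+ 2 / 2) * F y.
have dH (y : R) : is_derive y 1 H 0.
  have D := dF y.
  by rewrite /H; apply: is_derive_eq; rewrite /GRing.scale/=; field.
have := is_derive_0_is_cst xi 0 dH.
rewrite /H expr0n/= mulr0 mul0r expR0 mul1r.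
have -> : F 0 = (normal_peak s)^-1 * cos c.
  rewrite -(Rintegral_gauss m s0) -RintegralZr//; last exact: integrable_gauss.
  by apply: eq_Rintegral => x _; rewrite /f expr0 mul1r mul0r add0r.
move=> HF.
rewrite mulrAC -HF expRN mulrAC mulfV ?mul1r//.
by rewrite gt_eqF// expR_gt0.
Qed.

End trigonometric_moments.
End gaussian_line.

(** * Bounded measurable functions *)

Lemma EFin_Rintegral d (T : measurableType d) (R : realType)
    (nu : {measure set T -> \bar R}) (f : T -> R) :
  nu.-integrable setT (EFin \o f) ->
  (\int[nu]_x (f x)%:E)%E = (\int[nu]_x f x)%:E.
Proof.
move=> intf; rewrite fineK//.
by have := integrable_fin_num measurableT intf; exact.
Qed.

Lemma Rintegral_sum d (T : measurableType d) (R : realType)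
    (nu : {measure set T -> \bar R}) (I : Type) (r : seq I) (f : I -> T -> R) :
  (forall i, nu.-integrable setT (EFin \o f i)) ->
  \int[nu]_x (\sum_(i <- r) f i x) = \sum_(i <- r) \int[nu]_x f i x.
Proof.
move=> intf; rewrite /Rintegral.
under eq_integral do rewrite -sumEFin.
rewrite (@integral_sum _ _ _ nu setT measurableT _ (fun i x => (f i x)%:E))//.
rewrite (eq_bigr (fun i => (\int[nu]_x f i x)%:E)) ?sumEFin// => i _.
by rewrite EFin_Rintegral.
Qed.

Section bounded_measurable.
Context {R : realType} d (T : measurableType d).
Implicit Types (f g : T -> R) (N : probability T R).

(** Such functions are integrable against every probability measure and, unlike integrable functions
    in general, are closed under products. *)
Definition bounded_mfun f :=
  measurable_fun setT f /\ exists K, forall y, `|f y| <= K.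

Lemma bounded_mfun_integrable N f :
  bounded_mfun f -> N.-integrable setT (EFin \o f).
Proof.
move=> [mf [K fK]]; apply: measurable_bounded_integrable => //.
  by rewrite (le_lt_trans (probability_le1 _ _)) ?ltry.
exists K; split; first exact: num_real.
by move=> M KM y _ /=; exact: le_trans (fK y) (ltW KM).
Qed.

Lemma bounded_mfun_cst c : bounded_mfun (cst c).
Proof. by split => //; exists `|c|. Qed.

Lemma bounded_mfunM f g : bounded_mfun f -> bounded_mfun g ->
  bounded_mfun (fun y => f y * g y).
Proof.
move=> [mf [K fK]] [mg [L gL]]; split; first exact: measurable_funM.
by exists (K * L) => y; rewrite normrM ler_pM.
Qed.

Lemma bounded_mfunD f g : bounded_mfun f -> bounded_mfun g ->
  bounded_mfun (fun y => f y + g y).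
Proof.
move=> [mf [K fK]] [mg [L gL]]; split; first exact: measurable_funD.
by exists (K + L) => y; rewrite (le_trans (ler_normD _ _))// lerD.
Qed.

Lemma bounded_mfun_sum (I : Type) (r : seq I) (f : I -> T -> R) :
  (forall i, bounded_mfun (f i)) -> bounded_mfun (fun y => \sum_(i <- r) f i y).
Proof.
move=> bf; elim: r => [|i r IH].
  by under eq_fun do rewrite big_nil; exact: bounded_mfun_cst.
by under eq_fun do rewrite big_cons; exact: bounded_mfunD.
Qed.

Lemma bounded_mfun_prod (I : Type) (r : seq I) (f : I -> T -> R) :
  (forall i, bounded_mfun (f i)) -> bounded_mfun (fun y => \prod_(i <- r) f i y).
Proof.
move=> bf; elim: r => [|i r IH].
  by under eq_fun do rewrite big_nil; exact: bounded_mfun_cst.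
by under eq_fun do rewrite big_cons; exact: bounded_mfunM.
Qed.

Lemma bounded_mfun_cos f :
  measurable_fun setT f -> bounded_mfun (fun y => cos (f y)).
Proof.
split; last by exists 1 => y; exact: norm_cos_le1.
exact: measurableT_comp (continuous_measurable_fun (@continuous_cos R)) _.
Qed.

Lemma bounded_mfun_poly_gauss s f (k : nat) : s != 0 -> (k <= 2)%N ->
  measurable_fun setT f -> bounded_mfun (fun y => f y ^+ k * gauss s (f y)).
Proof.
move=> s0 k2 mf; split.
  apply: measurable_funM; first exact: measurable_funX.
  exact: measurableT_comp (measurable_gauss s) mf.
exists (1 + 4 * s ^+ 2) => y.
have := @norm_poly_gauss_le _ s (f y) k 1 s0 k2.
rewrite normr1 mulr1 => /(_ (lexx _)) /le_trans; apply.
by rewrite ler_piMr ?gauss_le1// addr_ge0// mulr_ge0// sqr_ge0.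
Qed.

Lemma bounded_mfun_lim (f_ : nat -> T -> R) f K :
  (forall n, measurable_fun setT (f_ n)) -> (forall n y, `|f_ n y| <= K) ->
  (forall y, f_ n y @[n --> \oo] --> f y) -> bounded_mfun f.
Proof.
move=> mf fK fcv; split.
  by apply: (measurable_fun_cvg mf) => y _; exact: fcv.
exists K => y; rewrite -(cvg_lim _ (cvg_norm (fcv y)))//.
apply: limr_le; last exact: nearW.
by apply/cvg_ex; exists `|f y|; exact: cvg_norm (fcv y).
Qed.

Lemma Rintegral_bounded_cvg N (f_ : nat -> T -> R) f K :
  (forall n, measurable_fun setT (f_ n)) -> (forall n y, `|f_ n y| <= K) ->
  (forall y, f_ n y @[n --> \oo] --> f y) ->
  \int[N]_y f_ n y @[n --> \oo] --> \int[N]_y f y.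
Proof.
move=> mf fK fcv.
have bf : bounded_mfun f := bounded_mfun_lim mf fK fcv.
apply: fine_cvg; rewrite -EFin_Rintegral; last exact: bounded_mfun_integrable.
apply: (@dominated_cvg _ _ _ N setT measurableT (fun n y => (f_ n y)%:E)
  (EFin \o f) (fun=> K%:E)) => //.
- by move=> n; apply/measurable_EFinP.
- by move=> y _; apply: cvg_EFin; [exact: nearW|exact: fcv].
- by apply: (@bounded_mfun_integrable _ (cst K)); exact: bounded_mfun_cst.
- by move=> n y _; rewrite lee_fin.
Qed.

End bounded_measurable.

(** * From Frechet functions to characteristic functions *)

(** Integrability on the product comes from Tonelli: the inner integral of |phi| is at most |K|
    times the Gaussian integral, which does not depend on the centre [X y], and [P] has mass 1. *)
Lemma Rintegral_gauss_fubini d (T : measurableType d) (R : realType)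
    (P : probability T R) (s K : R) (X : T -> R) (phi : T * R -> R) :
  s != 0 -> measurable_fun setT phi ->
  (forall y x, `|phi (y, x)| <= K * gauss s (x - X y)) ->
  \int[P]_y (\int[lebesgue_measure]_x phi (y, x)) =
  \int[lebesgue_measure]_x (\int[P]_y phi (y, x)).
Proof.
move=> s0 mphi phiK.
have int1 y : lebesgue_measure.-integrable setT (EFin \o (fun x => phi (y, x))).
  by apply: (integrable_gauss_dominated s0 _ (phiK y)); exact: measurableT_comp.
have int2 x : P.-integrable setT (EFin \o (fun y => phi (y, x))).
  apply: bounded_mfun_integrable; split; first exact: measurableT_comp.
  exists `|K| => y; rewrite (le_trans (phiK _ _))// (le_trans (ler_norm _))//.
  by rewrite normrM ler_piMr// ger0_norm ?gauss_ge0// gauss_le1.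
have intphi : (P \x @lebesgue_measure R)%E.-integrable setT (EFin \o phi).
  apply/integrable12ltyP; first exact/measurable_EFinP.
  apply: (@le_lt_trans _ _ (\int[P]_y (`|K| * (normal_peak s)^-1)%:E)%E); last first.
    by rewrite integral_cst//= probability_setT mule1 ltry.
  apply: ge0_le_integral => //.
  - by move=> y _; exact: integral_ge0.
  - apply: (measurable_fun_fubini_tonelli_F (m2 := @lebesgue_measure R)
      (abse \o (EFin \o phi))) => //=.
    by apply: measurableT_comp => //; exact/measurable_EFinP.
  - move=> y _; rewrite -(Rintegral_gauss (X y) s0) -RintegralZl//; last first.
      exact: integrable_gauss.
    have iK : lebesgue_measure.-integrable setT
        (fun x => (`|K| * gauss s (x - X y))%:E).
      rewrite (_ : (fun _ => _) = fun x => (`|K|%:E * (gauss s (x - X y))%:E)%E)//.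
      by apply: integrableZl => //; exact: integrable_gauss.
    rewrite -EFin_Rintegral//.
    apply: ge0_le_integral => //.
    + by apply: measurableT_comp => //; exact: measurable_int (int1 y).
    + exact: measurable_int iK.
    + move=> x _; rewrite lee_fin (le_trans (phiK _ _))//.
      by rewrite ler_wpM2r ?gauss_ge0// ler_norm.
have := Fubini intphi => /= F.
rewrite /Rintegral; congr fine.
transitivity (\int[P]_y (\int[lebesgue_measure]_x (phi (y, x))%:E))%E.
  by apply: eq_integral => y _; rewrite EFin_Rintegral.
by rewrite F; apply: eq_integral => x _; rewrite EFin_Rintegral.
Qed.

Section frechet_to_characteristic.
Context {R : realType} d (T : measurableType d) (n : nat) (X : 'I_n -> T -> R).
Hypothesis mX : forall i, measurable_fun setT (X i).
Variables (s : R) (s0 : s != 0) (P Q : probability T R).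

(** The flag [e] tells whether the coordinate carries the square: the exponent [e.*2] is 2 or 0. *)
Let kernel (e : bool) (t : R) := t ^+ e.*2 * gauss s t.

(** The Fourier transform of [kernel e], real because the kernel is even. *)
Let kernel_hat (e : bool) (xi : R) :=
  (if e then s ^+ 2 * (1 - s ^+ 2 * xi ^+ 2) else 1) *
  ((normal_peak s)^-1 * expR (- (s ^+ 2 * xi ^+ 2 / 2))).

(** Writing xi x + b = xi (x - m) + (xi m + b) reduces to the centred moments: convolution with the
    kernel multiplies a wave by the transform of the kernel. *)
Let Rintegral_kernel (e : bool) (m xi b : R) :
  \int[lebesgue_measure]_x (kernel e (x - m) * cos (xi * x + b)) =
  kernel_hat e xi * cos (xi * m + b).
Proof.
transitivity (\int[lebesgue_measure]_x ((x - m) ^+ e.*2 * gauss s (x - m) *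
    cos (xi * (x - m) + (xi * m + b)))).
  by apply: eq_Rintegral => x _; congr (_ * cos _); ring.
case: e; rewrite /kernel_hat /=.
  by rewrite Rintegral_sqr_gauss_cos// Rintegral_gauss_cos// !mulrA.
by rewrite Rintegral_gauss_cos// mul1r.
Qed.

Let kernel_le (e : bool) (t a : R) : `|a| <= 1 ->
  `|kernel e t * a| <= (1 + 4 * s ^+ 2) * gauss (Num.sqrt 2 * s) t.
Proof. by move=> a1; apply: norm_poly_gauss_le => //; case: e. Qed.

Variable xi : 'I_n -> R.

(** Index [j] names the summand z_j^2 of |z|^2, so only coordinate [j] carries the square;
    coordinates below [k] have already been replaced by their transforms. *)
Let factor (k : nat) (j : 'I_n) (x : 'I_n -> R) (y : T) (i : 'I_n) : R :=
  if (i < k)%N then kernel_hat (i == j) (xi i) else kernel (i == j) (x i - X i y).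

Let phase (k : nat) (x : 'I_n -> R) (y : T) (i : 'I_n) : R :=
  xi i * (if (i < k)%N then X i y else x i).

(* The first [k] coordinates of the centre [x] have been integrated out
   against the character of frequency [xi]. *)
Let partial_transform (k : nat) (x : 'I_n -> R) (b : R) (y : T) : R :=
  \sum_j (\prod_i factor k j x y i) * cos (\sum_i phase k x y i + b).

Let upd (x : 'I_n -> R) (i0 : 'I_n) (t : R) (i : 'I_n) :=
  if i == i0 then t else x i.

Let cofactor_ k j x y (i0 : 'I_n) := \prod_(i | i != i0) factor k j x y i.

Let cophase k x y (i0 : 'I_n) := \sum_(i | i != i0) phase k x y i.

(** Isolates the coordinate about to be integrated: the cofactor and the cophase do not involve [t],
    so [Rintegral_kernel] applies to what remains. The next lemma gives the matching form after
    integration. *)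
Let partial_transformE (k : 'I_n) x b y t :
  partial_transform k (upd x k t) b y =
  \sum_j cofactor_ k j x y k *
    (kernel (k == j) (t - X k y) * cos (xi k * t + (cophase k x y k + b))).
Proof.
rewrite /partial_transform; apply: eq_bigr => j _.
rewrite (bigD1 k)//= [X in cos (X + _)](bigD1 k)//=.
rewrite {1}/factor {1}/phase ltnn /upd eqxx mulrAC mulrC -addrA.
congr (_ * (_ * cos (_ + (_ + _)))).
- apply: eq_bigr => i ik; rewrite /factor.
  by case: ifP => //; rewrite (negbTE ik).
- apply: eq_bigr => i ik; rewrite /phase.
  by case: ifP => //; rewrite (negbTE ik).
Qed.

Let partial_transformSE (k : 'I_n) x b y :
  partial_transform k.+1 x b y =
  \sum_j cofactor_ k j x y k *
    (kernel_hat (k == j) (xi k) * cos (xi k * X k y + (cophase k x y k + b))).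
Proof.
rewrite /partial_transform; apply: eq_bigr => j _.
rewrite (bigD1 k)//= [X in cos (X + _)](bigD1 k)//=.
rewrite {1}/factor {1}/phase ltnS leqnn mulrAC mulrC -addrA.
congr (_ * (_ * cos (_ + (_ + _)))).
- apply: eq_bigr => i ik; rewrite /factor ltnS leq_eqVlt.
  by rewrite (negbTE (ik : (i : nat) != k)).
- apply: eq_bigr => i ik; rewrite /phase ltnS leq_eqVlt.
  by rewrite (negbTE (ik : (i : nat) != k)).
Qed.

(** A crude bound that serves both branches of [factor] and both values of [i == j]. *)
Let bnd (i : 'I_n) := (1 + 4 * s ^+ 2) +
  (`|kernel_hat true (xi i)| + `|kernel_hat false (xi i)|).

Let factor_le k j x y i : `|factor k j x y i| <= bnd i.
Proof.
have kt := normr_ge0 (kernel_hat true (xi i)).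
have kf := normr_ge0 (kernel_hat false (xi i)).
have s2 := sqr_ge0 s.
rewrite /factor /bnd; case: ifP => _.
  by case: (i == j); lra.
have := @kernel_le (i == j) (x i - X i y) 1 _; rewrite normr1 mulr1.
move=> /(_ (lexx _)) /le_trans; apply.
rewrite (@le_trans _ _ (1 + 4 * s ^+ 2))//; last by rewrite lerDl addr_ge0.
by rewrite ler_piMr ?gauss_le1//; lra.
Qed.

Let measurable_partial_transform k (x : T * R -> 'I_n -> R) b :
  (forall i, measurable_fun setT (x ^~ i)) ->
  measurable_fun setT (fun z => partial_transform k (x z) b z.1).
Proof.
move=> mx.
have mX1 i : measurable_fun setT (fun z : T * R => X i z.1).
  exact: (measurableT_comp (mX i) measurable_fst).
apply: measurable_sum => j; apply: measurable_funM.
- apply: measurable_prod => i _; rewrite /factor; case: (i < k)%N.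
    exact: measurable_cst.
  have mt : measurable_fun setT (fun z : T * R => x z i - X i z.1).
    by apply: measurable_funB => //; exact: mx.
  apply: measurable_funM; first exact: measurable_funX.
  exact: measurableT_comp (measurable_gauss s) mt.
- apply: measurableT_comp; first exact: (continuous_measurable_fun (@continuous_cos R)).
  apply: measurable_funD => //; apply: measurable_sum => i.
  by rewrite /phase; apply: measurable_funM => //; case: (i < k)%N.
Qed.

Let Rintegral_partial_transform (k : 'I_n) x b y :
  \int[lebesgue_measure]_t partial_transform k (upd x k t) b y =
  partial_transform k.+1 x b y.
Proof.
under eq_Rintegral do rewrite partial_transformE.
have intj j (a c : R) : lebesgue_measure.-integrable setT (EFin \o
    (fun t => kernel (k == j) (t - X k y) * cos (xi k * t + c))).
  apply: (integrable_gauss_dominated (m := X k y) (K := 1 + 4 * s ^+ 2)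
    (sqrt2M_neq0 s0)); last by move=> t; apply/kernel_le/norm_cos_le1.
  apply: continuous_measurable_fun.
  under eq_fun do rewrite -[X in xi k * X](subr0).
  exact: (continuous_poly_gauss s0 (@continuous_cosM _ _ _ _)).
rewrite Rintegral_sum; last first.
  move=> j; rewrite (_ : _ \o _ = fun t => ((cofactor_ k j x y k)%:E * (kernel
    (k == j) (t - X k y) * cos (xi k * t + (cophase k x y k + b)))%:E)%E)//.
  by apply: integrableZl => //; exact: intj.
rewrite partial_transformSE; apply: eq_bigr => j _.
by rewrite RintegralZl ?Rintegral_kernel//; exact: intj.
Qed.

Let partial_transform_le (k : 'I_n) x b y t :
  `|partial_transform k (upd x k t) b y| <=
  (\sum_(j < n) \prod_(i | i != k) bnd i * (1 + 4 * s ^+ 2)) *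
    gauss (Num.sqrt 2 * s) (t - X k y).
Proof.
rewrite partial_transformE (le_trans (ler_norm_sum _ _ _))// mulr_suml.
apply: ler_sum => j _; rewrite normrM -mulrA ler_pM//.
- rewrite normr_prod; apply: ler_prod => i _.
  by rewrite normr_ge0 factor_le.
- exact/kernel_le/norm_cos_le1.
Qed.

Let integrable_partial_transform (N : probability T R) k x b :
  N.-integrable setT (EFin \o partial_transform k x b).
Proof.
apply/bounded_mfun_integrable/bounded_mfun_sum => j; apply: bounded_mfunM.
- apply: bounded_mfun_prod => i; rewrite /factor; case: (i < k)%N.
    exact: bounded_mfun_cst.
  apply: (@bounded_mfun_poly_gauss _ _ _ _ (fun y => x i - X i y)) => //.
    by case: (_ == _).
  exact: measurable_funB.
- apply/bounded_mfun_cos/measurable_funD => //; apply: measurable_sum => i.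
  by apply: measurable_funM => //; case: (i < k)%N.
Qed.

Let measurable_upd (k : 'I_n) x b : measurable_fun setT
  (fun z : T * R => partial_transform k (upd x k z.2) b z.1).
Proof.
apply: (@measurable_partial_transform k (fun z => upd x k z.2)) => i.
rewrite /upd /=; case: (i == k); last exact: measurable_cst.
exact: measurable_snd.
Qed.

(** The equality of convolutions is integrated against a wave in the centre, one coordinate at a
    time. After all [n] coordinates the kernel has become its transform at [xi], a constant that the
    last hypothesis keeps away from 0. *)
Lemma characteristic_of_frechet b :
  (forall x : 'I_n -> R,
    \int[P]_y (\sum_j \prod_i ((x i - X i y) ^+ (i == j).*2 * gauss s (x i - X i y))) =
    \int[Q]_y (\sum_j \prod_i ((x i - X i y) ^+ (i == j).*2 * gauss s (x i - X i y)))) ->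
  n%:R - s ^+ 2 * \sum_i xi i ^+ 2 != 0 ->
  \int[P]_y cos (\sum_i xi i * X i y + b) =
  \int[Q]_y cos (\sum_i xi i * X i y + b).
Proof.
move=> PQ xi0.
have eqPQ k : (k <= n)%N -> forall x b,
    \int[P]_y partial_transform k x b y = \int[Q]_y partial_transform k x b y.
  elim: k => [_ x b'|k IH kn x b'].
    pose c := \sum_i xi i * x i.
    (* At stage 0 the phase does not involve [y], so the cosine leaves the integral; the shift [- c]
       makes the remaining cosine cos 0 = 1. *)
    have E0 b1 y : partial_transform 0 x b1 y =
        partial_transform 0 x (- c) y * cos (c + b1).
      by rewrite /partial_transform -!mulr_suml subrr cos0 mulr1.
    under eq_Rintegral do rewrite E0.
    under [in RHS]eq_Rintegral do rewrite E0.
    rewrite !RintegralZr//; [|exact: integrable_partial_transform..].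
    congr (_ * _).
    have E1 y : partial_transform 0 x (- c) y =
        \sum_j \prod_i ((x i - X i y) ^+ (i == j).*2 * gauss s (x i - X i y)).
      by rewrite /partial_transform -!mulr_suml subrr cos0 mulr1.
    under eq_Rintegral do rewrite E1.
    by under [in RHS]eq_Rintegral do rewrite E1.
  pose k' := Ordinal kn.
  (* Fubini brings the integral over the measure inside, where the induction hypothesis applies at
     each fixed [t]. *)
  have E (N : probability T R) : \int[N]_y partial_transform k.+1 x b' y =
      \int[lebesgue_measure]_t \int[N]_y partial_transform k (upd x k' t) b' y.
    rewrite -(@Rintegral_gauss_fubini _ _ _ N _ _ _
      (fun z => partial_transform k (upd x k' z.2) b' z.1) (sqrt2M_neq0 s0) _
      (fun y t => @partial_transform_le k' x b' y t)) /=; last exact: measurable_upd.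
    apply: eq_Rintegral => y _.
    by rewrite (Rintegral_partial_transform k' x b' y).
  rewrite !E; apply: eq_Rintegral => t _.
  by rewrite IH// ltnW.
pose C := \sum_(j < n) \prod_i kernel_hat (i == j) (xi i).
have C0 : C != 0.
  pose B := \prod_i ((normal_peak s)^-1 * expR (- (s ^+ 2 * xi i ^+ 2 / 2))).
  (* Summand [j] differs from [B] only by the factor s^2 (1 - s^2 xi_j^2) at i = j; the sum over [j]
     yields s^2 (n - s^2 |xi|^2). *)
  have -> : C = B * (s ^+ 2 * (n%:R - s ^+ 2 * \sum_i xi i ^+ 2)).
    rewrite mulr_sumr -[n in n%:R]card_ord -sum1_card natr_sum -sumrB mulr_sumr mulr_sumr.
    apply: eq_bigr => j _.
    rewrite big_split/= mulrC; congr (_ * _).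
    rewrite (bigD1 j)//= eqxx big1 ?mulr1//.
    by move=> i /negbTE ->.
  rewrite mulf_neq0// ?mulf_neq0 ?expf_neq0//.
  apply/prodf_neq0 => i _.
  by rewrite gt_eqF// mulr_gt0 ?expR_gt0// invr_gt0 normal_peak_gt0.
have E y : partial_transform n (fun=> 0) b y = C * cos (\sum_i xi i * X i y + b).
  rewrite mulr_suml; apply: eq_bigr => j _; congr (_ * cos (_ + _)).
  - by apply: eq_bigr => i _; rewrite /factor ltn_ord.
  - by apply: eq_bigr => i _; rewrite /phase ltn_ord.
have E' y : cos (\sum_i xi i * X i y + b) =
    C^-1 * partial_transform n (fun=> 0) b y by rewrite E mulKf.
under eq_Rintegral do rewrite E'.
under [in RHS]eq_Rintegral do rewrite E'.
by rewrite !RintegralZl ?eqPQ//; exact: integrable_partial_transform.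
Qed.

End frechet_to_characteristic.

(** * Uniqueness for characteristic functions *)

Section characteristic_uniqueness.
Context {R : realType} d (T : measurableType d) (n : nat) (X : 'I_n -> T -> R).
Hypothesis mX : forall i, measurable_fun setT (X i).
Variables (P Q : probability T R).

Let wave (a : 'I_n -> R) (b : R) (y : T) := cos (\sum_i a i * X i y + b).

Let bounded_wave a b : bounded_mfun (wave a b).
Proof.
apply/bounded_mfun_cos/measurable_funD => //; apply: measurable_sum => i.
exact: measurable_funM.
Qed.

(** The real phase [b] avoids complex exponentials: b = 0 and b = - pi / 2 give the real and
    imaginary parts of the characteristic functions of the measures weighted by [h]. *)
Definition same_waves (h : T -> R) := forall a b,
  \int[P]_y (h y * cos (\sum_i a i * X i y + b)) =
  \int[Q]_y (h y * cos (\sum_i a i * X i y + b)).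

(** Quantifying over all weights [h], and not only over h = 1, makes closure under products a mere
    composition. *)
Definition multiplier (u : T -> R) := bounded_mfun u /\
  forall h, bounded_mfun h -> same_waves h -> same_waves (fun y => h y * u y).

Lemma multiplier_cst c : multiplier (cst c).
Proof.
split=> [|h bh hw a b]; first exact: bounded_mfun_cst.
under eq_Rintegral do rewrite mulrAC.
under [in RHS]eq_Rintegral do rewrite mulrAC.
rewrite !RintegralZr ?hw//; apply: bounded_mfun_integrable;
  exact: (bounded_mfunM bh (bounded_wave a b)).
Qed.

Lemma multiplierD u v : multiplier u -> multiplier v ->
  multiplier (fun y => u y + v y).
Proof.
move=> [bu mu] [bv mv]; split=> [|h bh hw a b]; first exact: bounded_mfunD.
under eq_Rintegral do rewrite mulrDr mulrDl.
under [in RHS]eq_Rintegral do rewrite mulrDr mulrDl.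
have int (N : probability T R) (f : T -> R) : bounded_mfun f ->
    N.-integrable setT (EFin \o (fun y => h y * f y * wave a b y)).
  by move=> bf; apply/bounded_mfun_integrable/bounded_mfunM => //; exact: bounded_mfunM.
by rewrite !RintegralD ?mu ?mv//; exact: int.
Qed.

Lemma multiplierM u v : multiplier u -> multiplier v ->
  multiplier (fun y => u y * v y).
Proof.
move=> [bu mu] [bv mv]; split=> [|h bh hw]; first exact: bounded_mfunM.
rewrite (_ : (fun y => _) = (fun y => h y * u y * v y)).
  by apply: mv; [exact: bounded_mfunM|exact: mu].
by apply/funext => y; rewrite mulrA.
Qed.

Lemma multiplier_prod (I : Type) (r : seq I) (u : I -> T -> R) :
  (forall i, multiplier (u i)) -> multiplier (fun y => \prod_(i <- r) u i y).
Proof.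
move=> mu; elim: r => [|i r IH].
  by under eq_fun do rewrite big_nil; exact: multiplier_cst.
by under eq_fun do rewrite big_cons; exact: multiplierM.
Qed.

Lemma multiplierX u k : multiplier u -> multiplier (fun y => u y ^+ k).
Proof.
move=> mu; rewrite (_ : (fun y => _) = fun y => \prod_(i < k) u y).
  exact: multiplier_prod.
by apply/funext => y; rewrite prodr_const card_ord.
Qed.

(** Bounded convergence under [P] and under [Q]: the two sequences of integrals coincide, hence so
    do their limits. *)
Lemma multiplier_lim (u_ : nat -> T -> R) u K :
  (forall k, multiplier (u_ k)) -> (forall k y, `|u_ k y| <= K) ->
  (forall y, u_ k y @[k --> \oo] --> u y) -> multiplier u.
Proof.
move=> mu uK ucv.
have mu_ k : measurable_fun setT (u_ k) by have [[]] := mu k.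
split=> [|h bh hw a b]; first exact: bounded_mfun_lim mu_ uK ucv.
have [mh [L hL]] := bh.
have cv (N : probability T R) :
    \int[N]_y (h y * u_ k y * wave a b y) @[k --> \oo] -->
    \int[N]_y (h y * u y * wave a b y).
  apply: (@Rintegral_bounded_cvg _ _ _ N _ _ (L * K * 1)).
  - move=> k; apply: measurable_funM; last by have [] := bounded_wave a b.
    exact: measurable_funM.
  - move=> k y; rewrite normrM ler_pM ?norm_cos_le1//.
    by rewrite normrM ler_pM.
  - move=> y; apply: cvgM; last exact: cvg_cst.
    by apply: cvgM; [exact: cvg_cst|exact: ucv].
apply: (cvg_unique _ (cv P)) => //.
apply: cvg_trans (cv Q); apply: near_eq_cvg; apply: nearW => k /=.
by have [_ ->] := mu k.
Qed.

(** By the product-to-sum formula, a product of two waves is half the sum of the waves whose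
    frequencies and phases are the sums and the differences. *)
Lemma multiplier_wave a b : multiplier (wave a b).
Proof.
split=> [|h bh hw a' b']; first exact: bounded_wave.
have bhw a1 b1 (N : probability T R) :
    N.-integrable setT (EFin \o (fun y => h y * wave a1 b1 y)).
  by apply/bounded_mfun_integrable/bounded_mfunM.
have E y : h y * wave a b y * cos (\sum_i a' i * X i y + b') =
    2^-1 * (h y * wave (fun i => a i + a' i) (b + b') y +
            h y * wave (fun i => a i - a' i) (b - b') y).
  rewrite /wave.
  have -> : \sum_i (a i + a' i) * X i y + (b + b') =
      (\sum_i a i * X i y + b) + (\sum_i a' i * X i y + b').
    by under eq_bigr do rewrite mulrDl; rewrite big_split/=; ring.
  have -> : \sum_i (a i - a' i) * X i y + (b - b') =
      (\sum_i a i * X i y + b) - (\sum_i a' i * X i y + b').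
    by under eq_bigr do rewrite mulrBl; rewrite sumrB; ring.
  move: (\sum_i a i * X i y + b) (\sum_i a' i * X i y + b') => p q.
  by rewrite cosD cosB; field.
under eq_Rintegral do rewrite E.
under [in RHS]eq_Rintegral do rewrite E.
have bD (N : probability T R) : N.-integrable setT (EFin \o (fun y =>
    h y * wave (fun i => a i + a' i) (b + b') y +
    h y * wave (fun i => a i - a' i) (b - b') y)).
  by apply/bounded_mfun_integrable/bounded_mfunD; exact: bounded_mfunM.
rewrite !RintegralZl//; [|exact: bD..].
by rewrite !RintegralD//; [rewrite /wave !hw|exact: bhw..].
Qed.

(** The partial sums of the exponential series are polynomials in [u], hence multipliers, and e^K
    bounds them all when [K] bounds |u|. *)
Lemma multiplier_expR u : multiplier u -> multiplier (fun y => expR (u y)).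
Proof.
move=> mu; have [[_ [K uK]] _] := mu.
have cvgE (x : R) : series (exp_coeff x) k @[k --> \oo] --> expR x.
  exact: is_cvg_series_exp_coeff.
apply: (@multiplier_lim (fun k y => series (exp_coeff (u y)) k) _ (expR K)).
- elim=> [|k IH].
    rewrite (_ : (fun y => _) = cst 0); first exact: multiplier_cst.
    by apply/funext => y; rewrite /series/= big_geq.
  rewrite (_ : (fun y => _) = fun y =>
    series (exp_coeff (u y)) k + u y ^+ k * k`!%:R^-1).
    apply: multiplierD => //; apply: multiplierM; first exact: multiplierX.
    exact: multiplier_cst.
  by apply/funext => y; rewrite /series/= big_nat_recr.
- move=> k y; have K0 : 0 <= K := le_trans (normr_ge0 _) (uK y).
  apply: (@le_trans _ _ (series (exp_coeff K) k)).
    rewrite /series/= (le_trans (ler_norm_sum _ _ _))//; apply: ler_sum => i _.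
    by rewrite /exp_coeff/= normrM normrX normfV normr_nat ler_wpM2r// lerXn2r// nnegrE.
  apply: (nondecreasing_cvgn_le _ (is_cvg_series_exp_coeff K)).
  apply/nondecreasing_seqP => i; rewrite /series/= big_nat_recr//= lerDl.
  by rewrite /exp_coeff/= divr_ge0 ?exprn_ge0.
- by move=> y; exact: cvgE.
Qed.

(* The indicator of u > 0 is the limit of exp(- N exp(- N u)). *)
Lemma multiplier_gt0 u : multiplier u -> multiplier (fun y => (0 < u y)%R%:R).
Proof.
move=> mu.
pose w k y := expR (- k.+1%:R * expR (- k.+1%:R * u y)).
apply: (@multiplier_lim w _ 1).
- move=> k; apply: multiplier_expR; apply: multiplierM; first exact: multiplier_cst.
  by apply: multiplier_expR; apply: multiplierM => //; exact: multiplier_cst.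
- move=> k y; rewrite ger0_norm ?expR_ge0// -[leRHS]expR0 ler_expR mulNr oppr_le0.
  by rewrite mulr_ge0 ?expR_ge0.
(* Put v = [u y] and N = k + 1. If v > 0, the error is at most N e^(-N v) <= 4 / (v^2 N), because
   e^(N v) >= (N v)^2 / 4. If v <= 0, it is at most e^(-N) <= 1 / N. At v = 0 the quotient in [C] is
   0 by convention, and the maximum with 1 covers that case. *)
- move=> y; pose C := Num.max 1 (4 / u y ^+ 2).
  have bound k : `|w k y - (0 < u y)%R%:R| <= C * harmonic k.
    rewrite /w /harmonic/=; set v := u y; set N : R := k.+1%:R.
    have N0 : 0 < N by rewrite ltr0n.
    have [v0|v0] := ltP 0 v.
      rewrite (_ : true%:R = 1)//.
      have e0 := expR_ge0 (- N * v).
      rewrite distrC ger0_norm; last first.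
        rewrite subr_ge0 -[leRHS]expR0 ler_expR mulNr oppr_le0.
        by rewrite mulr_ge0 ?expR_ge0 ?(ltW N0).
      have h1 := expR_ge1Dx (- N * expR (- N * v)).
      apply: (@le_trans _ _ (N * expR (- N * v))).
        by rewrite -subr_ge0; lra.
      apply: (@le_trans _ _ (4 / v ^+ 2 * N^-1)); last first.
        by rewrite ler_wpM2r ?invr_ge0 ?(ltW N0)// le_max lexx orbT.
      rewrite mulNr expRN.
      have e1 : 1 + N * v / 2 <= expR (N * v / 2) := expR_ge1Dx _.
      have Nv : 0 < N * v by rewrite mulr_gt0.
      have e2 : (N * v) ^+ 2 / 4 <= expR (N * v).
        have -> : N * v = N * v / 2 + N * v / 2 by field.
        rewrite expRD.
        set q := N * v / 2 in e1 *; set E := expR q in e1 *.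
        have q0 : 0 < q by rewrite divr_gt0.
        nra.
      rewrite ler_pdivrMr ?expR_gt0//.
      have NE : N = 4 / v ^+ 2 / N * ((N * v) ^+ 2 / 4).
        by field; rewrite !gt_eqF.
      rewrite [leLHS]NE ler_wpM2l// divr_ge0 ?(ltW N0)// divr_ge0//.
      by rewrite sqr_ge0.
    rewrite (_ : false%:R = 0)// subr0 ger0_norm ?expR_ge0//.
    apply: (@le_trans _ _ N^-1); last first.
      by rewrite ler_peMl ?invr_ge0 ?(ltW N0)// le_max lexx.
    rewrite mulNr expRN lef_pV2 ?posrE ?expR_gt0//.
    apply: (@le_trans _ _ (expR N)).
      by rewrite (le_trans _ (expR_ge1Dx _))// lerDr.
    rewrite ler_expR ler_peMr ?(ltW N0)// -[leLHS]expR0 ler_expR.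
    by rewrite mulNr oppr_ge0 mulr_ge0_le0 ?(ltW N0).
  apply/subr_cvg0; apply: norm_cvg0.
  apply: (@squeeze_cvgr _ _ _ _ (cst 0) (fun k => C * harmonic k)).
  + by apply: nearW => k; rewrite normr_ge0 bound.
  + exact: cvg_cst.
  + by rewrite -(mulr0 C); apply: cvgMr; exact: cvg_harmonic.
Qed.

(* For N > |t|, the number sin (t / N) has the sign of t. *)
Lemma multiplier_halfspace i (e c : R) :
  multiplier (fun y => (0 < e * (X i y - c))%R%:R).
Proof.
pose t y := e * (X i y - c).
apply: (@multiplier_lim (fun k y => (0 < sin (t y / k.+1%:R))%R%:R) _ 1).
- move=> k; apply: (@multiplier_gt0 (fun y => sin (t y / k.+1%:R))).
  (* The sine is a wave with phase shifted by - pi / 2 and frequency supported on coordinate [i]. *)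
  rewrite (_ : (fun y => _) = wave (fun j => (j == i)%:R * (e / k.+1%:R))
    (- (e * c / k.+1%:R) - pi / 2)); first exact: multiplier_wave.
  apply/funext => y; rewrite /wave addrA cosBpihalf; congr sin.
  rewrite (bigD1 i)//= eqxx mul1r big1 => [|j /negbTE ->]; last by rewrite !mul0r.
  by rewrite /t; field.
- by move=> k y; case: (0 < _); rewrite ?normr1 ?normr0.
- move=> y; rewrite -/(t y); set z := t y.
  apply: cvg_near_cst; near=> k.
  have zk : `|z| < k.+1%:R.
    apply: (@lt_trans _ _ k%:R); last by rewrite ltr_nat.
    by near: k; exact: nbhs_infty_gtr.
  have k0 : 0 < k.+1%:R :> R by rewrite ltr0n.
  have pi1 : 1 < pi :> R by rewrite (lt_le_trans _ (pi_ge2 R)) ?ltr1n.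
  have pos (r : R) : 0 < r -> `|r| < k.+1%:R -> 0 < sin (r / k.+1%:R).
    move=> r0; rewrite gtr0_norm// => rk.
    apply: sin_gt0_pi; rewrite divr_gt0//=.
    by rewrite (lt_trans _ pi1)// ltr_pdivrMr// mul1r.
  congr (_%:R); have [z0|z0] := ltP 0 z; first by rewrite pos.
  move: z0; rewrite le_eqVlt => /predU1P[->|z0].
    by rewrite mul0r sin0 ltxx.
  have := pos (- z); rewrite oppr_gt0 normrN mulNr sinN oppr_gt0 => /(_ z0 zk).
  by move/ltW; rewrite leNgt => /negbTE ->.
Unshelve. all: by end_near. Qed.

(** Complements and finite unions are polynomial operations on indicators; countable unions are
    pointwise limits of finite ones. *)
Lemma sigma_algebra_multiplier :
  sigma_algebra setT [set A | multiplier (\1_A : T -> R)].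
Proof.
have mU A B : multiplier (\1_A : T -> R) -> multiplier (\1_B : T -> R) ->
    multiplier (\1_(A `|` B) : T -> R).
  move=> mA mB; rewrite (_ : \1_ _ = fun y =>
    \1_A y + \1_B y + cst (-1) y * (\1_A y * \1_B y)).
    apply: multiplierD; first exact: multiplierD.
    by apply: multiplierM; [exact: multiplier_cst|exact: multiplierM].
  apply/funext => y; rewrite !indicE in_setU /=.
  by case: (y \in A); case: (y \in B) => /=; ring.
split => /=.
- by rewrite indic0; exact: multiplier_cst.
- move=> A mA; rewrite setTD (_ : \1_ _ = fun y => cst 1 y + cst (-1) y * \1_A y).
    apply: multiplierD; first exact: multiplier_cst.
    by apply: multiplierM => //; exact: multiplier_cst.
  by apply/funext => y; rewrite !indicE in_setC; case: (y \in A) => /=; ring.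
- move=> A mA.
  apply: (@multiplier_lim (fun k => \1_(\big[setU/set0]_(i < k) A i)) _ 1).
  + elim=> [|k IH]; first by rewrite big_ord0 indic0; exact: multiplier_cst.
    by rewrite big_ord_recr /=; exact: mU.
  + by move=> k y; rewrite indicE; case: (_ \in _); rewrite ?normr1 ?normr0.
  (* At each point the indicators of the increasing finite unions are eventually constant. *)
  + move=> y; apply: cvg_near_cst.
    have [[j _ Ajy]|nA] := pselect ((\bigcup_k A k) y).
      exists j.+1 => // k /= jk; rewrite !indicE !mem_set//; first by exists j.
      by rewrite -bigcup_mkord; exists j.
    apply: nearW => k; rewrite !indicE !memNset// -bigcup_mkord => -[j _ Ajy].
    by apply: nA; exists j.
Qed.

(** At zero frequency and zero phase the wave is 1, and what is left is the integral of the
    indicator. *)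
Lemma multiplier_probability A : measurable A ->
  multiplier (\1_A : T -> R) -> same_waves (cst 1) -> P A = Q A.
Proof.
move=> mA [_ m1] w1.
have := m1 _ (bounded_mfun_cst _ 1) w1 (fun=> 0) 0.
have E y : cst 1 y * \1_A y * cos (\sum_(i < n) 0 * X i y + 0) = \1_A y :> R.
  by rewrite big1 => [|i _]; rewrite ?mul0r// addr0 cos0 mulr1 mul1r.
under eq_Rintegral do rewrite E.
under [in X in _ = X -> _]eq_Rintegral do rewrite E.
rewrite /Rintegral !integral_indic// !setIT => PQ.
by rewrite -[LHS]fineK ?fin_num_measure// PQ fineK ?fin_num_measure.
Qed.

End characteristic_uniqueness.

(* A frequency xi <> 0 on the sphere is the limit of (1 + 1/(k+1)) xi. *)
Lemma same_waves1_of_sphere {R : realType} d (T : measurableType d) (n : nat)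
    (X : 'I_n -> T -> R) (P Q : probability T R) (s : R) :
  (forall i, measurable_fun setT (X i)) -> s != 0 ->
  (forall xi b, n%:R - s ^+ 2 * \sum_i xi i ^+ 2 != 0 ->
    \int[P]_y cos (\sum_i xi i * X i y + b) =
    \int[Q]_y cos (\sum_i xi i * X i y + b)) ->
  same_waves X P Q (cst 1).
Proof.
move=> mX s0 PQ xi b.
under eq_Rintegral do rewrite mul1r.
under [in RHS]eq_Rintegral do rewrite mul1r.
have [/subr0_eq nE|nS] := eqVneq (n%:R - s ^+ 2 * \sum_i xi i ^+ 2) 0; last first.
  exact: PQ.
(* If xi = 0, then [nE] forces dimension 0; no scaling of xi leaves the sphere, but both integrands
   are the constant cos b. *)
have [S0|S0] := eqVneq (\sum_i xi i ^+ 2) 0.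
  have E y : cos (\sum_i xi i * X i y + b) = cos b.
    rewrite big1 ?add0r// => i _.
    move/eqP: S0; rewrite psumr_eq0; last by move=> j _; exact: sqr_ge0.
    by move/allP/(_ i); rewrite mem_index_enum sqrf_eq0 => /(_ isT)/eqP ->; rewrite mul0r.
  under eq_Rintegral do rewrite E.
  under [in RHS]eq_Rintegral do rewrite E.
  have cstE (N : probability T R) : \int[N]_y cos b = cos b.
    by rewrite Rintegral_cst//= probability_setT mulr1.
  by rewrite !cstE.
pose xik k i := (1 + harmonic k) * xi i.
have PQk k : \int[P]_y cos (\sum_i xik k i * X i y + b) =
             \int[Q]_y cos (\sum_i xik k i * X i y + b).
  apply: PQ; under eq_bigr do rewrite exprMn.
  rewrite -mulr_sumr nE.
  have -> : s ^+ 2 * \sum_i xi i ^+ 2 - s ^+ 2 * ((1 + harmonic k) ^+ 2 * \sum_i xi i ^+ 2)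
      = - (s ^+ 2 * (\sum_i xi i ^+ 2) * (harmonic k * (2 + harmonic k))) by ring.
  have h0 : 0 < harmonic k :> R by exact: harmonic_gt0.
  by rewrite oppr_eq0 !mulf_neq0 ?expf_neq0// gt_eqF// addr_gt0.
have cv (N : probability T R) :
    \int[N]_y cos (\sum_i xik k i * X i y + b) @[k --> \oo] -->
    \int[N]_y cos (\sum_i xi i * X i y + b).
  apply: (@Rintegral_bounded_cvg _ _ _ N _ _ 1).
  - move=> k; suff [] : bounded_mfun (fun y => cos (\sum_i xik k i * X i y + b)) by [].
    apply/bounded_mfun_cos/measurable_funD => //; apply: measurable_sum => i.
    exact: measurable_funM.
  - by move=> k y; exact: norm_cos_le1.
  - move=> y; apply: (@cvg_comp _ _ _ (fun k => \sum_i xik k i * X i y + b) cos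
      _ (nbhs (\sum_i xi i * X i y + b))); last exact: continuous_cos.
    apply: cvgD; last exact: cvg_cst.
    rewrite (_ : (fun k => _) =
        fun k => (1 + harmonic k) * \sum_i xi i * X i y); last first.
      apply/funext => k; rewrite mulr_sumr; apply: eq_bigr => i _.
      by rewrite mulrA.
    rewrite -[X in _ --> X]mul1r; apply: cvgM; last exact: cvg_cst.
    rewrite -[X in _ --> X]addr0; apply: cvgD; first exact: cvg_cst.
    exact: cvg_harmonic.
apply: (cvg_unique _ (cv P)) => //.
by apply: cvg_trans (cv Q); apply: near_eq_cvg; apply: nearW => k /=.
Qed.

(** * Open sets as countable unions of rational boxes *)

(** An open set is the union of the boxes inside it that have rational centre and radius 1 / (m +
    1), and there are only countably many of these. *)
Lemma sigma_algebra_open_rV {R : realType} n (G : set (set 'rV[R]_n)) :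
  sigma_algebra setT G ->
  (forall (c : 'I_n -> R) (r : R), G [set y | forall i, `|y ord0 i - c i| < r]) ->
  open `<=` G.
Proof.
move=> [G0 _ Gbigcup] Gbox U oU.
pose box (z : {ffun 'I_n -> rat} * nat) : set 'rV[R]_n :=
  [set y | forall i, `|y ord0 i - ratr (z.1 i)| < z.2.+1%:R^-1].
(* The boxes are enumerated through [unpickle]; a code that decodes to nothing, or to a box not
   inside [U], contributes the empty set. *)
pose B k := if (unpickle k : option ({ffun 'I_n -> rat} * nat)) is Some z
  then if `[< box z `<=` U >] then box z else set0 else set0.
suff -> : U = \bigcup_k B k.
  apply: Gbigcup => k; rewrite /B; case: unpickle => // z.
  by case: ifP => // _; exact: Gbox.
apply/seteqP; split => [y Uy|y [k _]]; last first.
  rewrite /B; case: unpickle => // z.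
  by case: ifPn => // /asboolP zU /zU.
have /nbhs_ballP[e /= e0 yeU] : nbhs y U by exact: open_nbhs_nbhs.
(* Twice the radius must stay below [e]: the rational centre is within one radius of [y], and every
   point of the box within one radius of the centre. *)
pose m := Num.truncn (2 / e).
have mE : m.+1%:R^-1 + m.+1%:R^-1 < e.
  have : 2 / e < m.+1%:R by exact: truncnS_gt.
  rewrite ltr_pdivrMr// => me.
  rewrite (_ : _ + _ = 2 / m.+1%:R); last by ring.
  by rewrite ltr_pdivrMr ?ltr0n// mulrC.
have q_ex i : exists q : rat, `|y ord0 i - ratr q| < m.+1%:R^-1.
  have yr : y ord0 i < y ord0 i + m.+1%:R^-1 by rewrite ltrDl invr_gt0 ltr0n.
  have [q] := rat_in_itvoo yr.
  rewrite in_itv/= => /andP[q1 q2]; exists q.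
  move: (ratr q) (m.+1%:R^-1) yr q1 q2 => p r yr q1 q2.
  by rewrite ltr_norml; apply/andP; split; lra.
pose q := [ffun i => projT1 (cid (q_ex i))].
have qE i : `|y ord0 i - ratr (q i)| < m.+1%:R^-1.
  by rewrite /q ffunE; case: cid.
exists (pickle (q, m)) => //; rewrite /B pickleK.
rewrite ifT //; apply/asboolP => z zq; apply: yeU.
split => // i j; rewrite (ord1 i) /ball/=.
have := zq j; have := qE j => /=.
move: (ratr (q j)) => p h1 h2.
apply: le_lt_trans mE.
rewrite (le_trans (ler_distD p _ _))// lerD// ?ltW//.
by rewrite distrC.
Qed.

(** * Coordinates on R^d and the conclusion *)

Lemma measurable_coord {R : realType} n (i : 'I_n) :
  measurable_fun setT (fun y : borel_rV R n => (y : 'rV[R]_n) ord0 i).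
Proof.
apply: (measurability _ (RGenOpens.measurableE R)) => _ [_ [a [b ->] <-]].
rewrite setTI; apply: sub_sigma_algebra.
by apply: open_comp; [move=> y _; exact: coord_continuous|exact: interval_open].
Qed.

(** The exponential of a sum of squares splits into one factor per coordinate, and each summand
    z_j^2 of |z|^2 joins the factor of its own coordinate. Evenness allows x - y in place of y - x,
    the form of a convolution. *)
Lemma frechet_integrandE {R : realType} n (x y : 'rV[R]_n) (s : R) :
  enorm (y - x) ^+ 2 * gauss_kernel x y s =
  ((2 * pi * s ^+ 2) `^ (n%:R / 2))^-1 *
  \sum_j \prod_i ((x ord0 i - y ord0 i) ^+ (i == j).*2 *
                  gauss s (x ord0 i - y ord0 i)).
Proof.
rewrite /gauss_kernel mulrCA; congr (_ * _).
rewrite /enorm sqr_sqrtr; last by apply: sumr_ge0 => i _; exact: sqr_ge0.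
have -> : expR (- ((\sum_(i < n) (y - x) ord0 i ^+ 2) / (2 * s ^+ 2))) =
    \prod_i gauss s (x ord0 i - y ord0 i).
  rewrite mulr_suml -sumrN expR_sum; apply: eq_bigr => i _.
  by rewrite /gauss !mxE -sqrrN opprB.
rewrite mulr_suml; apply: eq_bigr => j _; rewrite big_split/=; congr (_ * _).
rewrite (bigD1 j)//= eqxx big1 ?mulr1 => [|i /negbTE ->//].
by rewrite !mxE -sqrrN opprB.
Qed.

Theorem proposition4 (R : realType) (d : nat) (sigma : R)
    (sigma_gt0 : 0 < sigma) (alpha beta : probability (borel_rV R d) R)
    (eqV : forall x : 'rV[R]_d, frechet alpha x sigma = frechet beta x sigma) :
  forall A : set (borel_rV R d), measurable A -> alpha A = beta A.
Proof.
have s0 : sigma != 0 by rewrite gt_eqF.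
pose X (i : 'I_d) (y : borel_rV R d) : R := (y : 'rV[R]_d) ord0 i.
have mX i : measurable_fun setT (X i) := measurable_coord i.
pose S (x : 'I_d -> R) (y : borel_rV R d) := \sum_j \prod_i
  ((x i - X i y) ^+ (i == j).*2 * gauss sigma (x i - X i y)).
have eqS x : \int[alpha]_y S x y = \int[beta]_y S x y.
  have bS : bounded_mfun (S x).
    apply: bounded_mfun_sum => j; apply: bounded_mfun_prod => i.
    apply: (bounded_mfun_poly_gauss (f := fun y => x i - X i y)) => //.
      by case: (_ == _).
    exact: measurable_funB.
  (* The normalising constant is nonzero because [sigma] is positive, so it cancels. *)
  pose c := ((2 * pi * sigma ^+ 2) `^ (d%:R / 2))^-1.
  have c0 : c != 0.
    by rewrite invr_eq0 gt_eqF// powR_gt0// !mulr_gt0// ?pi_gt0// exprn_gt0.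
  have E (N : probability (borel_rV R d) R) :
      frechet N (\row_i x i) sigma = c * \int[N]_y S x y.
    rewrite -RintegralZl//; last exact: bounded_mfun_integrable.
    apply: eq_Rintegral => y _; rewrite frechet_integrandE; congr (_ * _).
    by apply: eq_bigr => j _; apply: eq_bigr => i _; rewrite mxE.
  by apply: (mulfI c0); rewrite -!E.
have w1 : same_waves X alpha beta (cst 1).
  apply: (same_waves1_of_sphere mX s0) => xi b xi0.
  exact: (characteristic_of_frechet mX s0 b eqS xi0).
move=> A mA; apply: (multiplier_probability mA _ w1).
have sG := sigma_algebra_multiplier mX alpha beta.
(* The Borel sets form the smallest sigma-algebra containing the open sets, so boxes suffice; a box
   is an intersection of two half-spaces per coordinate, and its indicator is the product of
   theirs. *)
apply: (smallest_sub sG _ mA); apply: sigma_algebra_open_rV => // c r /=.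
rewrite (_ : \1_ _ = fun y => \prod_i
  ((0 < 1 * (X i y - (c i - r)))%R%:R * (0 < (-1) * (X i y - (c i + r)))%R%:R)).
  apply: (multiplier_prod mX) => i.
  by apply: multiplierM; exact: (multiplier_halfspace mX).
apply/funext => y; rewrite indicE.
have E i : (`|X i y - c i| < r) =
    (0 < 1 * (X i y - (c i - r))) && (0 < (-1) * (X i y - (c i + r))).
  by rewrite ltr_norml; apply/andP/andP => -[h1 h2]; split; lra.
have [yc|yc] := pselect (forall i, `|X i y - c i| < r).
  rewrite mem_set// big1 => [//|i _].
  by have := yc i; rewrite E => /andP[-> ->]; rewrite mulr1.
rewrite memNset//.
have [i /negP] : exists i, ~ (`|X i y - c i| < r) by exact/existsNP.
rewrite E negb_and => nE; rewrite (bigD1 i)//=.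
by case/orP: nE => /negbTE ->; rewrite ?mul0r ?mulr0 ?mul0r.
Qed.
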